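(* Let $0<1/n\ll 1/\ell\ll\varepsilon\ll\gamma\ll 1/r$ where $n,\ell,r\in\mathbb N$ and $r\ge 3$. Suppose that $G$ is a digraph on $n$ vertices such that for every $x\in V(G)$, $d^+(x)\ge (1-1/r-\varepsilon)n$ or $d^-(x)\ge (1-1/r-\varepsilon)n$. Further suppose that for any $x,y\in V(G)$, if $d^+(x)<(1-1/r-\varepsilon)n$ and $d^-(y)<(1-1/r-\varepsilon)n$ then $xy\notin E(G)$. Then at least one of the following holds: (i) $G$ contains a $T_r$-packing that covers all but at most $\ell$ vertices; (ii) $G$ contains a $\gamma$-independent set of size at least $n/r$.
   Context: Hierarchy notation: $0<a\ll b\ll c$ means the constants are chosen from right to left, each sufficiently small in terms of those to its right (there are increasing functions $f,g$ such that the statement holds whenever $b\le f(c)$ and $a\le g(b)$); longer hierarchies are analogous. A digraph has no loops and at most one edge in each direction between any two vertices; $xy$ denotes the edge from $x$ to $y$; $d^\pm(x)$ are out-/indegree. $T_r$ is the transitive tournament on $r$ vertices. A $T_r$-packing is a collection of vertex-disjoint (not necessarily induced) copies of $T_r$. For $G$ on $n$ vertices, $S\subseteq V(G)$ is $\gamma$-independent if $G[S]$ has at most $\gamma n^2$ edges. *)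

(* Defs.v *)
From mathcomp Require Import all_boot all_order all_algebra.
From mathcomp Require Import reals.

Set Implicit Arguments.
Unset Strict Implicit.
Unset Printing Implicit Defensive.

Import Order.TTheory GRing.Theory Num.Theory.
Local Open Scope ring_scope.

(* A digraph on V is an irreflexive relation e : rel V, where e x y means that
   xy is an edge; both e x y and e y x may hold. *)
Section Digraph.

Variables (V : finType) (e : rel V).

Definition outdeg (x : V) : nat := #|[set y | e x y]|.

Definition indeg (x : V) : nat := #|[set y | e y x]|.

Definition edges_in (S : {set V}) : {set V * V} :=
  [set p | [&& p.1 \in S, p.2 \in S & e p.1 p.2]].

(* The bound is in terms of #|V|, not of #|S|. *)
Definition gamma_independent (R : realType) (gamma : R) (S : {set V}) : Prop :=
  #|edges_in S|%:R <= gamma * #|V|%:R ^+ 2.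

Definition transitive_tournament (r : nat) : rel 'I_r := fun i j => (i < j)%N.

(* Copies need not be induced. Since T_r has no nontrivial automorphism,
   embeddings of T_r correspond bijectively to subgraphs isomorphic to T_r. *)
Definition Tr_copy (r : nat) (f : {ffun 'I_r -> V}) : Prop :=
  injective f /\ forall i j, transitive_tournament i j -> e (f i) (f j).

Definition Tr_packing (r : nat) (P : {set {ffun 'I_r -> V}}) : Prop :=
  (forall f, f \in P -> Tr_copy f) /\
  (forall f g, f \in P -> g \in P -> f != g -> [disjoint codom f & codom g]).

Definition covered (r : nat) (P : {set {ffun 'I_r -> V}}) : {set V} :=
  \bigcup_(f in P) [set f i | i : 'I_r].

End Digraph.

(* The functions behind "a << b", read as 0 < a <= f b with b > 0. Positivity
   is needed for the bound on a to be satisfiable. *)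
Definition hierarchy_fun (R : realType) (f : R -> R) : Prop :=
  (forall x, 0 < x -> 0 < f x) /\
  (forall x y, 0 < x -> x < y -> f x < f y).

(* Main.v *)
(** Partition the vertices into transitive cliques of order at most [r] so that
    the weight, the sum of [(r + 1) ^ |K|] over the blocks [K], is maximal. The
    degree conditions give every block [K] a direction for each of its vertices
    such that a clique lying in all the chosen neighbourhoods can be inserted
    into [K], and each of these neighbourhoods misses at most [n / r + eps n]
    vertices. Suppose that [r + 1] blocks have the same size [j < r]. By
    maximality their vertices have at least [(r + 1) j |Q| / r] missing
    neighbours in total in any block [Q], and the degree conditions make this an
    equality for all but [O(eps n)] blocks. For the other blocks [Q] we have
    [|Q| = r], each vertex of the [r + 1] blocks misses exactly one vertex of
    [Q], and the sets of missed vertices coincide. Hence [Q] has at least [j]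
    vertices after whose removal it can be refilled from any one of the [r + 1]
    blocks. These are almost [j n / r] vertices in all, so a greedy choice of
    [j - 1] of them leaves almost [n / r] common candidates; unless these span
    few edges, this yields a clique of order [j + 1] with vertices in distinct
    blocks. Taking it out of its blocks and refilling them from [j + 1 <= r] of
    the blocks of size [j] increases the weight, a contradiction. So at most [r]
    blocks have any given size [j < r], and all but [r ^ 3] vertices lie in
    blocks of order [r]. *)
Require Import Defs.
From mathcomp Require Import all_boot all_order all_algebra.
From mathcomp Require Import reals.
From mathcomp Require Import zify ring lra.

Set Implicit Arguments.
Unset Strict Implicit.
Unset Printing Implicit Defensive.

Import Order.TTheory GRing.Theory Num.Theory.
Local Open Scope ring_scope.

(** * Transitive cliques as vertex sets, and insertion of new vertices into them *)

Section TransitiveSets.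

Local Open Scope nat_scope.

Variables (V : finType) (e : rel V).
Hypothesis e_irr : irreflexive e.

(** Ranging over tuples of length [#|S|] makes the predicate boolean. This length is no restriction:
    since [e] is irreflexive, a list that is pairwise related by [e] has distinct entries. *)
Definition transitive_set (S : {set V}) : bool :=
  [exists t : #|S|.-tuple V, pairwise e t && (S == [set x in t])].

Lemma transitive_setP (S : {set V}) :
  reflect (exists2 s : seq V, pairwise e s & S = [set x in s])
          (transitive_set S).
Proof.
apply: (iffP existsP) => [[t /andP[et /eqP St]]|[s es Ss]]; first by exists t.
have szs : size s == #|S|.
  by rewrite Ss cardsE; apply/eqP/esym/card_uniqP/(pairwise_uniq e_irr).
by exists (Tuple szs); rewrite /= es; apply/eqP.
Qed.

Lemma transitive_setS (S T : {set V}) :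
  S \subset T -> transitive_set T -> transitive_set S.
Proof.
move=> /subsetP sST /transitive_setP[s es Ts]; apply/transitive_setP.
exists [seq x <- s | x \in S]; first exact: pairwise_filter.
apply/setP=> x; rewrite inE mem_filter.
by case: (boolP (x \in S)) => //= /sST; rewrite Ts inE.
Qed.

Lemma transitive_set1 (x : V) : transitive_set [set x].
Proof.
by apply/transitive_setP; exists [:: x] => //; apply/setP=> y; rewrite !inE.
Qed.

Lemma transitive_set2 (x y : V) : e x y -> transitive_set [set x; y].
Proof.
move=> exy; apply/transitive_setP; exists [:: x; y] => /=; first by rewrite exy.
by apply/setP=> z; rewrite !inE.
Qed.

(* [a] and [b] are the vertices of small outdegree and of small indegree. As no
   edge goes from [a] to [b], the order of a transitive clique [K] can be cut so
   that [a] does not occur before the cut and [b] does not occur after it. [N x]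
   is the outneighbourhood of [x] before the cut and the inneighbourhood after
   it: what lies in all [N x] can be inserted at the cut. *)
Lemma transitive_set_directions (a b : pred V) (K : {set V}) :
    (forall x, ~~ (a x && b x)) -> (forall x y, a x -> b y -> ~~ e x y) ->
    transitive_set K ->
  exists N : V -> {set V},
    (forall x, x \in K ->
       (N x = [set y | e x y] /\ ~~ a x) \/
       (N x = [set y | e y x] /\ ~~ b x)) /\
    (forall K' T : {set V}, K' \subset K -> transitive_set T ->
       (forall x, x \in K' -> T \subset N x) -> transitive_set (K' :|: T)).
Proof.
move=> ab eab /transitive_setP[s es ->].
set s1 := take (find a s) s; set s2 := drop (find a s) s.
have def_s : s = s1 ++ s2 by rewrite cat_take_drop.
have a1 x : x \in s1 -> ~~ a x.
  move=> /(nthP x)[i]; rewrite size_takel ?find_size // => lti <-.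
  by rewrite nth_take // before_find.
have b2 x : x \in s2 -> ~~ b x.
  have [ha|ha] := boolP (has a s); last first.
    by rewrite /s2 (hasNfind ha) drop_size.
  (* The first vertex [y] of [s2] satisfies [a] and sends an edge to every later vertex of [s2], so
     no later vertex satisfies [b]. *)
  case def2: s2 => [|y s2'] //.
  have ay : a y.
    by have := nth_find y ha; rewrite -[find a s]addn0 -nth_drop -/s2 def2.
  have : pairwise e s2 by move: es; rewrite def_s pairwise_cat => /and3P[].
  rewrite def2 /= => /andP[/allP ey _]; rewrite inE => /orP[/eqP->|/ey eyx].
    by apply: contraNN (ab y) => by'; rewrite ay.
  by apply/negP=> /(eab _ _ ay); rewrite eyx.
exists (fun x => if x \in s1 then [set y | e x y] else [set y | e y x]).
split=> [x|K' T sK' /transitive_setP[t et ->] KT].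
  rewrite inE def_s mem_cat; case: ifP => [/a1|_ /b2]; first by left.
  by right.
have us := pairwise_uniq e_irr es.
apply/transitive_setP.
exists ([seq x <- s1 | x \in K'] ++ t ++ [seq x <- s2 | x \in K']); last first.
  apply/setP=> x; rewrite !inE !mem_cat !mem_filter orbCA orbC.
  congr (_ || _); rewrite -andb_orr -mem_cat -def_s.
  by case: (boolP (x \in K')) => //= /(subsetP sK'); rewrite inE.
move: es us; rewrite def_s pairwise_cat cat_uniq => /and3P[s12 es1 es2].
case/and3P=> _ /hasPn s12d _.
rewrite !pairwise_cat !pairwise_filter // et allrel_catr !andbT /=.
apply/andP; split; first (apply/andP; split); apply/allrelP=> x y.
- rewrite mem_filter => /andP[xK' xs1] yt.
  by have /subsetP/(_ y) := KT x xK'; rewrite xs1 !inE; apply.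
- rewrite !mem_filter => /andP[_ xs1] /andP[_ ys2].
  by have /allrelP := s12; apply.
- rewrite mem_filter => xt /andP[yK' /s12d /negbTE ys1].
  by have /subsetP/(_ x) := KT y yK'; rewrite ys1 !inE; apply.
Qed.

Lemma transitive_set_embedding (S : {set V}) (r : nat) :
  transitive_set S -> #|S| = r ->
  exists f : {ffun 'I_r -> V}, Tr_copy e f /\ [set f i | i : 'I_r] = S.
Proof.
move=> /existsP[t /andP[et /eqP St]] Sr; case: r / Sr.
have ut := pairwise_uniq e_irr et.
exists [ffun i => tnth t i]; split; last first.
  apply/setP=> x; rewrite [in RHS]St inE; apply/imsetP/idP.
    by case=> i _ ->; rewrite ffunE mem_tnth.
  by move=> /tnthP[i ->]; exists i; rewrite ?ffunE.
split=> [i j|i j].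
  by rewrite !ffunE => /(tuple_uniqP _ ut).
rewrite /transitive_tournament !ffunE => ltij.
have x0 := tnth t i; rewrite !(tnth_nth x0).
by apply: (pairwiseP x0 et) => //; rewrite inE /= size_tuple.
Qed.

End TransitiveSets.

(** * Disjoint cliques of maximal weight, for an abstract notion of clique *)

Section CliqueFamilies.

Local Open Scope nat_scope.

Variables (V : finType) (clique : pred {set V}) (r : nat).
Hypothesis clique1 : forall x, clique [set x].

Definition clique_family (P : {set {set V}}) : bool :=
  trivIset P && [forall K in P, [&& K != set0, clique K & #|K| <= r]].

Lemma clique_familyP (P : {set {set V}}) :
  reflect (trivIset P /\
           forall K, K \in P -> [/\ K != set0, clique K & #|K| <= r])
          (clique_family P).
Proof.
apply: (iffP andP) => -[tP kP]; split=> //.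
  by move=> K /(forall_inP kP)/and3P.
by apply/forall_inP=> K /kP/and3P.
Qed.

(* In base [r.+1], a block that gains a vertex outweighs up to [r] discarded
   blocks of its old size. *)
Definition weight (P : {set {set V}}) : nat := \sum_(K in P) r.+1 ^ #|K|.

Definition optimal (P : {set {set V}}) : Prop :=
  clique_family P /\ forall Q, clique_family Q -> weight Q <= weight P.

Lemma optimal_exists : exists P, optimal P.
Proof.
have fam0 : clique_family set0.
  by apply/clique_familyP; split=> [|K]; [apply/trivIsetP=> A B|]; rewrite inE.
case: (arg_maxnP weight fam0) => P famP maxP.
by exists P; split=> // Q /maxP.
Qed.

Lemma clique_family1 (K : {set V}) :
  K != set0 -> clique K -> #|K| <= r -> clique_family [set K].
Proof.
move=> K0 cK Kr; apply/clique_familyP; split=> [|A].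
  by apply/trivIsetP=> A B; rewrite !inE => /eqP-> /eqP->; rewrite eqxx.
by rewrite inE => /eqP->.
Qed.

Lemma clique_familyU1 (K : {set V}) (P : {set {set V}}) :
    K != set0 -> clique K -> #|K| <= r -> clique_family P ->
    (forall A, A \in P -> [disjoint K & A]) ->
  clique_family (K |: P).
Proof.
move=> K0 cK Kr /clique_familyP[/trivIsetP tP famP] dKP.
apply/clique_familyP; split=> [|A]; last by case/setU1P=> [->|/famP].
apply/trivIsetP=> A B /setU1P[->|AP] /setU1P[->|BP]; rewrite ?eqxx // => AB.
- exact: dKP.
- by rewrite disjoint_sym dKP.
- exact: tP.
Qed.

Section Optimal.

Variables (P : {set {set V}}) (optP : optimal P).

Lemma optimal_trivIset : trivIset P.
Proof. by case: optP => /clique_familyP[]. Qed.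

Lemma optimal_clique K : K \in P -> clique K.
Proof. by case: optP => /clique_familyP[_ kP] _ /kP[]. Qed.

Lemma optimal_card K : K \in P -> #|K| <= r.
Proof. by case: optP => /clique_familyP[_ kP] _ /kP[]. Qed.

Lemma optimal_neq0 K : K \in P -> K != set0.
Proof. by case: optP => /clique_familyP[_ kP] _ /kP[]. Qed.

Lemma optimal_disjoint A B : A \in P -> B \in P -> A != B -> [disjoint A & B].
Proof. exact: (trivIsetP optimal_trivIset). Qed.

Lemma optimal_replace (X Y : {set {set V}}) :
    X \subset P -> clique_family Y ->
    (forall A B, A \in P :\: X -> B \in Y -> [disjoint A & B]) ->
  weight Y <= weight X.
Proof.
move=> sXP famY dXY; case: (optP) => famP maxP.
have /clique_familyP[tP kP] := famP; have /clique_familyP[tY kY] := famY.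
have famU : clique_family ((P :\: X) :|: Y).
  apply/clique_familyP; split=> [|K].
    apply/trivIsetP=> A B; rewrite !(inE, in_setU) => AP BP.
    case/orP: AP BP => [/andP[AX AP]|AY] /orP[/andP[BX BP]|BY] AB.
    - exact: (trivIsetP tP).
    - by apply: dXY => //; rewrite inE AX.
    - by rewrite disjoint_sym; apply: dXY => //; rewrite inE BX.
    - exact: (trivIsetP tY).
  by case/setUP=> [/setDP[/kP]|/kY].
have := maxP _ famU; rewrite /weight.
rewrite [leqRHS](big_setID X) /= (setIidPr sXP) addnC.
rewrite (eq_bigl [in [predU P :\: X & Y]]); last by move=> K; rewrite !inE.
rewrite bigU /=; first by rewrite leq_add2l.
(* A block common to both families would be disjoint from itself, hence empty; so the weights add
   up. *)
rewrite -setI_eq0; apply/eqP/setP=> K; rewrite in_set0.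
apply/negP=> /setIP[KX KY].
have := dXY K K KX KY; rewrite -setI_eq0 setIid.
by have [/negPf->] := kY K KY.
Qed.

Lemma optimal_exchange (X Y : {set {set V}}) :
    X \subset P -> clique_family Y -> cover Y \subset cover X ->
  weight Y <= weight X.
Proof.
move=> sXP famY sYX; apply: optimal_replace => // A B /setDP[AP AX] BY.
apply/pred0Pn=> -[x /= /andP[xA xB]].
have: x \in cover X.
  by apply: (subsetP sYX); apply/bigcupP; exists B.
case/bigcupP=> C CX xC.
have CP := subsetP sXP C CX.
move: AX; suff ->: A = C by rewrite CX.
have tP := optimal_trivIset.
by rewrite -(def_pblock tP AP xA) (def_pblock tP CP xC).
Qed.

(** An uncovered vertex could be added as a singleton block. *)
Lemma optimal_cover : 0 < r -> cover P = [set: V].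
Proof.
move=> r0; apply/setP=> x; rewrite inE; apply/negPn/negP=> xP.
have fam1 : clique_family [set [set x]].
  apply: clique_family1; rewrite ?cards1 //.
  by apply/set0Pn; exists x; rewrite inE.
have : weight [set [set x]] <= weight set0.
  apply: optimal_replace; rewrite ?sub0set // => A B /setDP[AP _].
  rewrite inE => /eqP->; rewrite disjoint_sym disjoints1.
  by apply: contra xP => xA; apply/bigcupP; exists A.
by rewrite /weight big_set1 big_set0 cards1.
Qed.

End Optimal.

End CliqueFamilies.

(** * The augmentation argument *)

Lemma card_bigcup_le (I T : finType) (A : {pred I}) (F : I -> {set T}) :
  (#|\bigcup_(i in A) F i| <= \sum_(i in A) #|F i|)%N.
Proof.
elim/big_ind2: _ => [|n1 S1 n2 S2 le1 le2|//]; first by rewrite cards0.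
by apply: leq_trans (leq_add le1 le2); rewrite leq_card_setU.
Qed.

Lemma card_setD_sum (T : finType) (A B : {set T}) :
  #|A :\: B| = (\sum_(x in A) (x \notin B))%N.
Proof.
rewrite -sum1_card big_mkcond [RHS]big_mkcond; apply: eq_bigr => x _.
by rewrite inE; do 2 case: (x \in _).
Qed.

(** The gain in an exchange: a block of weight [p] grows by one vertex, and the blocks given up for
    it weigh [q1] and [q2]. *)
Lemma two_powers_lt (r p q1 q2 : nat) :
  (1 < r -> 0 < p -> q1 <= p -> q2 <= p -> q1 + q2 < r.+1 * p)%N.
Proof. by move=> *; nia. Qed.

Section Augmentation.

Local Open Scope nat_scope.

(* [N K x] is the neighbourhood of [x] in the direction that [x] has as a vertex
   of the clique [K]; [E] stands for [r * eps * n]. *)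
Variables (V : finType) (clique : pred {set V}) (r E : nat).
Variable N : {set V} -> V -> {set V}.
Hypothesis r_gt1 : 1 < r.
Hypothesis clique1 : forall x, clique [set x].
Hypothesis cliqueS : forall S T : {set V}, S \subset T -> clique T -> clique S.
Hypothesis N_irr : forall K x, clique K -> x \in K -> x \notin N K x.
Hypothesis N_deg :
  forall K x, clique K -> x \in K -> r * #|~: N K x| <= #|V| + E.
Hypothesis N_ext : forall K K' T : {set V},
  clique K -> K' \subset K -> clique T ->
  (forall x, x \in K' -> T \subset N K x) -> clique (K' :|: T).

Variables (P : {set {set V}}) (optP : optimal clique r P).

Let cliqueP K : K \in P -> clique K := optimal_clique optP (K := K).
Let tP : trivIset P := optimal_trivIset optP.

Lemma weightU1_le (K : {set V}) (X : {set {set V}}) :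
  weight r (K |: X) <= r.+1 ^ #|K| + weight r X.
Proof.
rewrite /weight; have [KX|KX] := boolP (K \in X).
  by rewrite (setUidPr _) ?sub1set // leq_addl.
by rewrite big_setU1.
Qed.

Lemma weight1 (K : {set V}) : weight r [set K] = r.+1 ^ #|K|.
Proof. exact: big_set1. Qed.

Lemma clique_extend (K : {set V}) (y : V) :
  clique K -> (forall x, x \in K -> y \in N K x) -> clique (y |: K).
Proof.
move=> cK yK; rewrite setUC; apply: (N_ext cK) => // x xK.
by rewrite sub1set yK.
Qed.

Lemma clique_extend_by (K T : {set V}) (x : V) :
  clique K -> x \in K -> clique T -> T \subset N K x -> clique (x |: T).
Proof.
move=> cK xK cT TN; apply: (N_ext cK) => // [|z]; first by rewrite sub1set.
by rewrite inE => /eqP->.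
Qed.

Lemma sub_cover2 (A K Q : {set V}) (X : {set {set V}}) :
  K \in X -> Q \in X -> A \subset K :|: Q -> A \subset cover X.
Proof.
move=> KX QX; move/subset_trans; apply; apply/subsetP=> x.
by case/setUP=> xK; apply/bigcupP; [exists K | exists Q].
Qed.

(** Otherwise [K] could take [y], which outweighs discarding the rest of [Q]. *)
Lemma no_absorption (K Q : {set V}) (y : V) :
    K \in P -> Q \in P -> #|Q| <= #|K| < r -> y \in Q ->
  exists2 x, x \in K & y \notin N K x.
Proof.
move=> KP QP /andP[QK Kr] yQ.
have [/exists_inP//|] := boolP [exists x in K, y \notin N K x].
rewrite negb_exists_in => /forall_inP yN.
have {}yN x : x \in K -> y \in N K x by move/yN; rewrite negbK.
have yK : y \notin K.
  by apply/negP=> yK; have := N_irr (cliqueP KP) yK; rewrite yN.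
have : weight r [set y |: K] <= weight r [set K; Q].
  apply: (optimal_exchange optP).
  - by apply/subsetP=> A /set2P[->|->].
  - apply: clique_family1; last by rewrite cardsU1 yK.
      by apply/set0Pn; exists y; rewrite setU11.
    exact: clique_extend (cliqueP KP) yN.
  - rewrite /cover big_set1; apply: sub_cover2 (set21 _ _) (set22 _ _) _.
    by rewrite subUset sub1set inE yQ orbT subsetUl.
rewrite weight1 cardsU1 yK => /leq_trans/(_ (weightU1_le _ _)).
by rewrite weight1 expnS leqNgt two_powers_lt ?expn_gt0 ?leq_pexp2l.
Qed.

(** Otherwise [Q] could take [x], which outweighs discarding the rest of the smaller block [K]. *)
Lemma no_domination (K Q : {set V}) (x : V) :
    K \in P -> Q \in P -> #|K| < #|Q| < r -> x \in K -> 0 < #|Q :\: N K x|.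
Proof.
move=> KP QP /andP[KQ Qr] xK; rewrite lt0n cards_eq0 setD_eq0; apply/negP=> QN.
have xQ : x \notin Q.
  by apply/negP=> /(subsetP QN); apply/negP/N_irr => //; apply: cliqueP.
have : weight r [set x |: Q] <= weight r [set K; Q].
  apply: (optimal_exchange optP).
  - by apply/subsetP=> A /set2P[->|->].
  - apply: clique_family1; last by rewrite cardsU1 xQ.
      by apply/set0Pn; exists x; rewrite setU11.
    by apply: clique_extend_by QN => //; apply: cliqueP.
  - rewrite /cover big_set1; apply: sub_cover2 (set21 _ _) (set22 _ _) _.
    by rewrite subUset sub1set inE xK subsetUr.
rewrite weight1 cardsU1 xQ => /leq_trans/(_ (weightU1_le _ _)).
by rewrite weight1 expnS leqNgt two_powers_lt ?expn_gt0 ?leq_pexp2l // ltnW.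
Qed.

(** Otherwise [y] could move from [Q] to [K1] and be replaced in [Q] by [x]. Then [Q] keeps its
    order, and the growth of [K1] outweighs the loss of [K2]. *)
Lemma no_rotation (K1 K2 Q : {set V}) (x y : V) :
    K1 \in P -> K2 \in P -> Q \in P -> K1 != K2 ->
    #|K2| = #|K1| -> #|K1| < r -> #|Q| = r ->
    x \in K2 -> y \in Q -> (forall z, z \in K1 -> y \in N K1 z) ->
  ~~ (Q :\ y \subset N K2 x).
Proof.
move=> K1P K2P QP K12 cK12 K1r Qr xK2 yQ yN; apply/negP=> QN.
have K1Q : K1 != Q by apply: contraTneq K1r => ->; rewrite Qr ltnn.
have K2Q : K2 != Q by apply: contraTneq K1r => K2Q; rewrite -cK12 K2Q Qr ltnn.
have dis A B z : A \in P -> B \in P -> A != B -> z \in A -> z \notin B.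
  by move=> AP BP AB zA; rewrite (disjointFr (optimal_disjoint optP AP BP AB)).
have yK1 : y \notin K1 by apply: (dis Q) => //; rewrite eq_sym.
have yK2 : y \notin K2 by apply: (dis Q) => //; rewrite eq_sym.
have xQ : x \notin Q by apply: (dis K2).
have xK1 : x \notin K1 by apply: (dis K2); rewrite // eq_sym.
have xQy : x \notin Q :\ y by rewrite !inE negb_and xQ orbT.
have cQ' : #|x |: Q :\ y| = r by rewrite cardsU1 xQy -Qr [in RHS](cardsD1 y) yQ.
have dKQ : [disjoint y |: K1 & x |: Q :\ y].
  apply/pred0Pn=> -[z /= /andP[]]; rewrite !inE.
  case/orP=> [/eqP->|zK1].
    by rewrite eqxx orbF => /eqP xy; rewrite xy xK2 in yK2.
  case/orP=> [/eqP zx|/andP[_ zQ]]; first by rewrite -zx zK1 in xK1.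
  by have := dis _ _ _ K1P QP K1Q zK1; rewrite zQ.
set Y := [set y |: K1; x |: Q :\ y].
have : weight r Y <= weight r [set K1; K2; Q].
  apply: (optimal_exchange optP).
  - by apply/subsetP=> A; rewrite !inE => /orP[/orP[]|] /eqP->.
  - apply: clique_familyU1.
    + by apply/set0Pn; exists y; rewrite setU11.
    + exact: clique_extend (cliqueP K1P) yN.
    + by rewrite cardsU1 yK1.
    + apply: clique_family1; last by rewrite cQ'.
        by apply/set0Pn; exists x; rewrite setU11.
      apply: clique_extend_by QN => //; first exact: cliqueP.
      by apply: cliqueS (subD1set _ _) _; apply: cliqueP.
    + by move=> A; rewrite inE => /eqP->.
  - apply/subsetP=> z /bigcupP[A /set2P[->|->]] zA; apply/bigcupP.
      move: zA; rewrite !inE => /orP[/eqP->|zK1].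
        by exists Q; rewrite ?inE ?eqxx ?orbT.
      by exists K1; rewrite ?inE ?eqxx ?orbT.
    move: zA; rewrite !inE => /orP[/eqP->|/andP[_ zQ]].
      by exists K2; rewrite ?inE ?eqxx ?orbT.
    by exists Q; rewrite ?inE ?eqxx ?orbT.
have YN : y |: K1 \notin [set x |: Q :\ y].
  rewrite inE; apply: contraTneq dKQ => ->; rewrite -setI_eq0 setIid.
  by apply/set0Pn; exists x; rewrite setU11.
rewrite [weight r Y]big_setU1 //= -/(weight _ _) weight1 cQ' cardsU1 yK1.
rewrite setUC => /leq_trans/(_ (weightU1_le _ _)); rewrite addnC Qr leq_add2l.
move=> /leq_trans/(_ (weightU1_le _ _)); rewrite weight1 cK12.
by rewrite expnS leqNgt two_powers_lt // expn_gt0.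
Qed.

(** * Counting the missing neighbours of [r + 1] blocks of equal order *)

Variables (F : {set {set V}}) (j : nat).
Hypothesis sFP : F \subset P.
Hypothesis cardF : #|F| = r.+1.
Hypothesis cardF_mem : forall K, K \in F -> #|K| = j.
Hypothesis j_lt_r : 0 < j < r.

Let FP K : K \in F -> K \in P := subsetP sFP K.
Let Fclique K : K \in F -> clique K := fun KF => cliqueP (FP KF).
Let coverP : cover P = setT := optimal_cover clique1 optP (ltnW r_gt1).

Definition misses (Q : {set V}) : nat :=
  \sum_(K in F) \sum_(x in K) #|Q :\: N K x|.

(** Among the blocks of [P], these are the ones with equality in the bound
    [r.+1 * j * #|Q| <= r * misses Q]. *)
Definition good (Q : {set V}) : bool :=
  (#|Q| == r) && [forall K in F, forall x in K, #|Q :\: N K x| == 1].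

(** Double counting: the blocks of [P] partition the vertices, so each of the [r.+1 * j] vertices in
    blocks of [F] contributes all its missing neighbours. *)
Lemma misses_total : r * \sum_(Q in P) misses Q <= r.+1 * j * (#|V| + E).
Proof.
rewrite /misses exchange_big big_distrr /=.
rewrite -cardF -mulnA -sum_nat_const; apply: leq_sum => K KF.
rewrite exchange_big big_distrr /= -(cardF_mem KF) -sum_nat_const.
apply: leq_sum => x xK.
apply: leq_trans (N_deg (Fclique KF) xK).
under eq_bigr => Q _ do rewrite card_setD_sum.
by rewrite -(big_trivIset _ tP) coverP -card_setD_sum setTD.
Qed.

Lemma card_le_misses (K Q : {set V}) :
    (forall y, y \in Q -> exists2 x, x \in K & y \notin N K x) ->
  #|Q| <= \sum_(x in K) #|Q :\: N K x|.
Proof.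
move=> QK; apply: leq_trans (card_bigcup_le _ _).
apply/subset_leq_card/subsetP=> y yQ; have [x xK yN] := QK y yQ.
by apply/bigcupP; exists x; rewrite // inE yN.
Qed.

(** If [#|Q| <= j], then [no_absorption] gives at least [#|Q|] misses for each [K] in [F]; otherwise
    [no_domination] gives at least [j]. Multiplied by [r], either number exceeds [j * #|Q|], because
    both [j] and [#|Q|] are below [r]. *)
Lemma misses_small (Q : {set V}) :
  Q \in P -> #|Q| < r -> r.+1 * (j * #|Q|).+1 <= r * misses Q.
Proof.
move=> QP Qr; rewrite -cardF -sum_nat_const /misses big_distrr /=.
apply: leq_sum => K KF.
have Q0 : 0 < #|Q| by rewrite card_gt0 (optimal_neq0 optP).
have KP := FP KF; have cK := cardF_mem KF.
have [Qj|jQ] := leqP #|Q| j.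
  have : #|Q| <= \sum_(x in K) #|Q :\: N K x|.
    apply: card_le_misses => y yQ.
    by apply: (no_absorption KP QP) => //; rewrite cK Qj; case/andP: j_lt_r.
  by move: (\sum_(x in K) _); case/andP: j_lt_r; nia.
have : \sum_(x in K) 1 <= \sum_(x in K) #|Q :\: N K x|.
  by apply: leq_sum => x; apply: (no_domination KP QP); rewrite cK jQ.
rewrite sum1_card cK.
by move: (\sum_(x in K) _) => m; case/andP: j_lt_r; nia.
Qed.

(** If every vertex misses something in [Q], the bound is clear, with equality only for good [Q]. If
    some [x] in [K] misses nothing, then by [no_rotation] each of the other [r] blocks of [F] misses
    every vertex of [Q]. This gives [r * r] misses, which is at least [r.+1 * j + 1] as [j < r]. *)
Lemma misses_full (Q : {set V}) :
  Q \in P -> #|Q| = r -> r.+1 * j + ~~ good Q <= misses Q.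
Proof.
move=> QP Qr.
have [/forall_inP pos|] :=
    boolP [forall K in F, [forall x in K, 0 < #|Q :\: N K x|]].
  have le1 : \sum_(K in F) \sum_(x in K) 1 <= misses Q
      ?= iff [forall K in F, forall x in K, 1 == #|Q :\: N K x|].
    apply: leqif_sum => K KF; apply: leqif_sum => x xK; split=> //.
    by have /forall_inP := pos K KF; apply.
  have sum1 : \sum_(K in F) \sum_(x in K) 1 = r.+1 * j.
    rewrite -cardF -sum_nat_const; apply: eq_bigr => K KF.
    by rewrite sum1_card cardF_mem.
  rewrite sum1 in le1.
  have -> : good Q = [forall K in F, forall x in K, 1 == #|Q :\: N K x|].
    rewrite /good Qr eqxx /=; apply: eq_forallb => K; congr (_ ==> _).
    by apply: eq_forallb => x; rewrite eq_sym.
  case: (boolP [forall K in F, _]) le1 => /= [_ [le1 _]|_ le1].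
    by rewrite addn0.
  by rewrite addn1 (ltn_leqif le1).
case/forall_inPn=> K KF /forall_inPn[x xK].
rewrite -eqn0Ngt cards_eq0 setD_eq0 => QN.
have : \sum_(L in F :\ K) r <= misses Q.
  rewrite /misses [leqRHS](big_setD1 K) //=; apply: leq_trans (leq_addl _ _).
  apply: leq_sum => L /setD1P[LK LF]; rewrite -[X in X <= _]Qr.
  apply: card_le_misses => y yQ; apply/exists_inP; apply: contraT.
  rewrite negb_exists_in => /forall_inP yN.
  have {}yN z : z \in L -> y \in N L z by move/yN; rewrite negbK.
  have cKL : #|K| = #|L| by rewrite !cardF_mem.
  have Lr : #|L| < r by rewrite cardF_mem //; case/andP: j_lt_r.
  case/negP: (no_rotation (FP LF) (FP KF) QP LK cKL Lr Qr xK yQ yN).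
  exact: subset_trans (subD1set _ _) QN.
rewrite sum_nat_const; have := cardsD1 K F; rewrite KF cardF add1n => -[<-].
by move: j_lt_r; case: (good Q) => /=; nia.
Qed.

Lemma misses_ge (Q : {set V}) :
  Q \in P -> r.+1 * j * #|Q| + ~~ good Q <= r * misses Q.
Proof.
move=> QP; have := optimal_card optP QP; rewrite leq_eqVlt => /orP[/eqP Qr|Qr].
  have := misses_full QP Qr; rewrite Qr.
  by move: r_gt1; case: (good Q) => /=; nia.
have := misses_small QP Qr; have := leq_b1 (~~ good Q).
by nia.
Qed.

(** Summing [misses_ge] over [P] and comparing with [misses_total], the main terms cancel, and each
    bad block uses up one unit of the error term. *)
Lemma card_bad : #|[set Q in P | ~~ good Q]| <= r.+1 * j * E.
Proof.
have : \sum_(Q in P) (r.+1 * j * #|Q| + ~~ good Q)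
    <= r * \sum_(Q in P) misses Q.
  by rewrite big_distrr /=; apply: leq_sum => Q; apply: misses_ge.
move=> /leq_trans/(_ misses_total).
rewrite big_split /= -big_distrr /= (eqP tP) coverP cardsT mulnDr leq_add2l.
apply: leq_trans; rewrite -sum1dep_card big_mkcondr /=.
by apply: leq_sum => Q _; case: (good Q).
Qed.

Lemma good_misses (K Q : {set V}) (x : V) :
  good Q -> K \in F -> x \in K -> exists d, Q :\: N K x = [set d].
Proof. by case/andP=> _ /forall_inP gQ /gQ/forall_inP/[apply]/cards1P. Qed.

(** * Vertices that can be taken out of good blocks *)

Definition missed (K Q : {set V}) : {set V} := \bigcup_(x in K) (Q :\: N K x).

(** Suppose that [y] is missed by some [x] in [K2] but by no vertex of [K1]. As [Q] is good, [x]
    misses only [y], so [y] can move to [K1] and [x] can replace it, against [no_rotation]. *)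
Lemma good_missed (K1 K2 Q : {set V}) :
    Q \in P -> good Q -> K1 \in F -> K2 \in F ->
  missed K2 Q = missed K1 Q.
Proof.
move=> QP gQ.
have Qr : #|Q| = r by case/andP: gQ => /eqP.
suff sub L1 L2 : L1 \in F -> L2 \in F -> missed L2 Q \subset missed L1 Q.
  by move=> F1 F2; apply/eqP; rewrite eqEsubset !sub.
move=> F1 F2; have [->//|L12] := eqVneq L1 L2.
apply/subsetP=> y /bigcupP[x xL2 yx]; apply: contraT => yL1.
have yQ : y \in Q by case/setDP: yx.
have yN z : z \in L1 -> y \in N L1 z.
  move=> zL1; apply: contraNT yL1 => yN.
  by apply/bigcupP; exists z; rewrite // inE yN.
have cL : #|L2| = #|L1| by rewrite !cardF_mem.
have Lr : #|L1| < r by rewrite cardF_mem //; case/andP: j_lt_r.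
case/negP: (no_rotation (FP F1) (FP F2) QP L12 cL Lr Qr xL2 yQ yN).
have [d def_d] := good_misses gQ F2 xL2.
move: yx; rewrite def_d inE => /eqP->.
by rewrite -def_d subDset; apply/subsetP=> z zQ; rewrite !inE zQ andbT orNb.
Qed.

(* Each [K] in [F] can refill [Q] once [w] has been taken out. *)
Definition available (Q : {set V}) : {set V} :=
  [set w in Q | [forall K in F, exists Q' : {set V},
     [&& clique Q', #|Q'| == r, Q' \subset K :|: Q & w \notin Q']]].

(** Every missed vertex is available: in each [K], a vertex that misses only it can take its place.
    This suffices if at least [j] vertices are missed. If fewer are, a pigeonhole argument in each
    [K] makes all of [Q] available. *)
Lemma card_available (Q : {set V}) :
  Q \in P -> good Q -> j <= #|available Q|.
Proof.
move=> QP gQ.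
have Qr : #|Q| = r by case/andP: gQ => /eqP.
have disKQ K x : K \in F -> x \in K -> x \notin Q.
  move=> KF xK; rewrite (disjointFr (optimal_disjoint optP (FP KF) QP _)) //.
  apply: contraTneq j_lt_r => KQ.
  by rewrite -(cardF_mem KF) KQ Qr ltnn andbF.
have [K0 K0F] : exists K0, K0 \in F by apply/card_gt0P; rewrite cardF.
have missed_sub : missed K0 Q \subset available Q.
  apply/subsetP=> w wM; rewrite inE; apply/andP; split.
    by case/bigcupP: wM => x _ /setDP[].
  apply/forall_inP=> K KF; move: wM; rewrite (good_missed QP gQ KF K0F).
  case/bigcupP=> x xK wx; have [d def_d] := good_misses gQ KF xK.
  have wQ : w \in Q by case/setDP: wx.
  have xQ := disKQ K x KF xK.
  apply/existsP; exists (x |: Q :\ w); apply/and4P; split.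
  - apply: (clique_extend_by (Fclique KF)) => //.
      exact: cliqueS (subD1set _ _) (cliqueP QP).
    move: wx; rewrite def_d inE => /eqP->.
    by rewrite -def_d subDset; apply/subsetP=> z zQ; rewrite !inE zQ andbT orNb.
  - by rewrite cardsU1 !inE negb_and xQ orbT -Qr [in X in _ == X](cardsD1 w) wQ.
  - apply/subsetP=> z; rewrite !inE => /orP[/eqP->|/andP[_ ->]].
      by rewrite xK.
    by rewrite orbT.
  - by rewrite !inE eqxx orbF; apply: contraNneq xQ => <-.
have [jM|Mj] := leqP j #|missed K0 Q|.
  exact: leq_trans jM (subset_leq_card missed_sub).
suff -> : available Q = Q by rewrite Qr; case/andP: j_lt_r => _ /ltnW.
apply/setP=> w; have [wM|wM] := boolP (w \in missed K0 Q).
  by rewrite (subsetP missed_sub) //; case/bigcupP: wM => x _ /setDP[].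
rewrite inE; case wQ: (w \in Q) => //=; apply/forall_inP=> K KF.
rewrite (good_missed QP gQ KF K0F) in Mj wM.
have [f fP] : exists f, forall x, x \in K -> Q :\: N K x = [set f x].
  have ex x : exists d, x \in K -> Q :\: N K x = [set d].
    have [xK|xK] := boolP (x \in K); last by exists w.
    by have [d] := good_misses gQ KF xK; exists d.
  by have [f fP] := fin_all_exists ex; exists f.
have fM x : x \in K -> f x \in missed K Q.
  by move=> xK; apply/bigcupP; exists x; rewrite // fP // set11.
(* Fewer than [j] vertices are missed, so two vertices of [K] miss the same one;
   they replace it and [w]. *)
have /dinjectivePn[x xK [y /andP[/= yx yK] fxy]] : ~~ dinjectiveb f (mem K).
  apply: contraTN Mj => /dinjectiveP injf; rewrite -leqNgt -(cardF_mem KF).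
  rewrite -(card_in_imset injf); apply/subset_leq_card/subsetP=> z.
  by case/imsetP=> x /fM xM ->.
have dQ : f x \in Q by have /bigcupP[? _ /setDP[]] := fM x xK.
have dw : f x != w by apply: contraNneq wM => <-; apply: fM.
have disQ z : z \in [set x; y] -> z \notin Q.
  by case/set2P=> ->; apply: (disKQ K).
apply/existsP; exists ([set x; y] :|: (Q :\ w :\ f x)); apply/and4P; split.
- apply: (N_ext (Fclique KF)).
  + by rewrite subUset !sub1set xK.
  + apply: cliqueS (cliqueP QP).
    exact: subset_trans (subD1set _ _) (subD1set _ _).
  + suff QN z : z \in K -> f z = f x -> Q :\ w :\ f x \subset N K z.
      by move=> z /set2P[] ->; apply: QN.
    move=> zK fzx; apply/subsetP=> v; rewrite !inE => /and3P[vd _ vQ].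
    apply: contraR vd => vN.
    by have := fP z zK => /setP/(_ v); rewrite !inE vN vQ fzx.
- rewrite cardsU (_ : _ :&: _ = set0) ?cards0 ?subn0; last first.
    apply/setP=> z; rewrite !in_setI in_set0.
    apply/negP=> /andP[/disQ /negPf zQ].
    by rewrite !inE zQ !andbF.
  rewrite cards2 [x == y]eq_sym yx -Qr [in X in _ == X](cardsD1 w) wQ.
  by rewrite [in X in _ == X](cardsD1 (f x)) !inE dw dQ.
- apply/subsetP=> z; rewrite !inE => /orP[/orP[]/eqP->|/and3P[_ _ ->]].
  + by rewrite xK.
  + by rewrite yK.
  + by rewrite orbT.
- rewrite !inE eqxx /= andbF orbF negb_or.
  by apply/andP; split; apply: contraTneq wQ => ->; apply: (disKQ K).
Qed.

(** * Transversal cliques of exchangeable vertices *)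

Definition exchangeable : {set V} :=
  \bigcup_(Q in P | good Q) available Q.

Lemma exchangeableP (w : V) :
  reflect [/\ pblock P w \in P, good (pblock P w)
            & w \in available (pblock P w)]
          (w \in exchangeable).
Proof.
apply: (iffP bigcupP) => [[Q /andP[QP gQ] wQ]|[QP gQ wQ]]; last first.
  by exists (pblock P w); rewrite ?QP.
suff -> : pblock P w = Q by [].
by apply: (def_pblock tP QP); move: wQ; rewrite inE => /andP[].
Qed.

Lemma mem_block (w : V) : w \in pblock P w.
Proof. by rewrite mem_pblock coverP inE. Qed.

Lemma block_eq (A B : {set V}) (z : V) :
  A \in P -> B \in P -> z \in A -> z \in B -> A = B.
Proof.
by move=> AP BP zA zB; rewrite -(def_pblock tP AP zA) (def_pblock tP BP zB).
Qed.

(** Blocks have order at most [r], so [P] has at least [#|V| / r] of them; all but the few bad ones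
    contribute at least [j] vertices each. *)
Lemma card_exchangeable :
  j * #|V| <= r * #|exchangeable| + j * r * (r.+1 * j * E).
Proof.
have le_good : j * #|[set Q in P | good Q]| <= #|exchangeable|.
  have -> : #|exchangeable| = \sum_(Q in P) \sum_(x in Q) (x \in exchangeable).
    rewrite -(big_trivIset _ tP) coverP -sum1_card big_mkcond /=.
    by apply: eq_big => x; [rewrite inE|case: (x \in _)].
  rewrite mulnC -sum1dep_card big_mkcondr big_distrl /=.
  apply: leq_sum => Q QP; case: (boolP (good Q)) => // gQ; rewrite mul1n.
  apply: leq_trans (card_available QP gQ) _; rewrite -sum1_card.
  rewrite [leqLHS]big_mkcond [leqRHS]big_mkcond; apply: leq_sum => x _.
  case: ifP => // xa; have -> : x \in Q by move: xa; rewrite inE => /andP[].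
  by rewrite lt0b; apply/bigcupP; exists Q; rewrite ?QP.
have le_P : #|V| <= r * #|P|.
  rewrite -cardsT -coverP -(eqP tP) mulnC -sum_nat_const.
  by apply: leq_sum => Q; apply: (optimal_card optP).
have card_P : #|P| = #|[set Q in P | good Q]| + #|[set Q in P | ~~ good Q]|.
  rewrite -(cardsID [set Q | good Q] P); congr (_ + _); apply: eq_card => Q.
    by rewrite !inE.
  by rewrite !inE andbC.
move: le_P le_good card_bad; rewrite card_P.
move: #|[set Q in P | good Q]| #|[set Q in P | ~~ good Q]|.
move=> g b le_P le_g le_b.
have : j * #|V| <= r * (j * g) + j * r * b by nia.
move=> /leq_trans; apply; apply: leq_add.
  by rewrite leq_mul2l le_g orbT.
by rewrite leq_mul2l le_b orbT.
Qed.

(** The directions are those of the clique [T] itself. Leaving out the blocks that meet [T] keeps an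
    extended clique transversal. *)
Definition extensions (T : {set V}) : {set V} :=
  exchangeable :\: \bigcup_(x in T) (~: N T x :|: pblock P x).

Lemma card_extensions (T : {set V}) : clique T ->
  r * #|exchangeable| <= r * #|extensions T| + #|T| * (#|V| + E + r * r).
Proof.
move=> cT; rewrite -sum_nat_const.
have : #|exchangeable| <= #|extensions T| + \sum_(x in T) (#|~: N T x| + r).
  rewrite -[leqLHS](cardsID (\bigcup_(x in T) (~: N T x :|: pblock P x))) addnC.
  rewrite leq_add2l; apply: leq_trans (subset_leq_card (subsetIr _ _)) _.
  apply: leq_trans (card_bigcup_le _ _) _; apply: leq_sum => x _.
  apply: leq_trans (leq_card_setU _ _) _; rewrite leq_add2l.
  by apply: (optimal_card optP); rewrite pblock_mem // coverP inE.
rewrite -(leq_pmul2l (ltnW r_gt1)) => /leq_trans; apply.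
rewrite mulnDr leq_add2l big_distrr /=; apply: leq_sum => x xT.
by rewrite mulnDr leq_add2r; apply: N_deg.
Qed.

Lemma extensionsP (T : {set V}) (u : V) : u \in extensions T ->
  u \in exchangeable /\
  forall x, x \in T -> u \in N T x /\ pblock P u != pblock P x.
Proof.
move=> /setDP[uZ uN]; split=> // x xT.
have : u \notin ~: N T x :|: pblock P x.
  by apply: contra uN => uN; apply/bigcupP; exists x.
rewrite !inE negb_or negbK => /andP[-> ub]; split=> //.
by apply: contraNneq ub => <-; apply: mem_block.
Qed.

Lemma weightU_le (X Y : {set {set V}}) :
  weight r (X :|: Y) <= weight r X + weight r Y.
Proof.
rewrite /weight [leqLHS]big_mkcond [X in _ <= X + _]big_mkcond.
rewrite [X in _ <= _ + X]big_mkcond -big_split /=; apply: leq_sum => K _.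
by rewrite in_setU; do 2 case: (K \in _) => //=; rewrite ?leq_addr ?addn0.
Qed.

(** Having distinct blocks, the vertices can be taken out simultaneously and each block refilled
    from its own member of [F]. *)
Definition transversal_clique (T : {set V}) : Prop :=
  [/\ clique T, T \subset exchangeable & {in T &, injective (pblock P)}].

Lemma transversal_cliqueU (T U : {set V}) :
    transversal_clique T -> transversal_clique U -> U \subset extensions T ->
  transversal_clique (T :|: U) /\ #|T :|: U| = #|T| + #|U|.
Proof.
move=> [cT sT iT] [cU sU iU] /subsetP UT.
have TU x y : x \in T -> y \in U -> pblock P y != pblock P x.
  by move=> xT /UT/extensionsP[_ /(_ x xT)[]].
split; last first.
  rewrite cardsU (_ : T :&: U = set0) ?cards0 ?subn0 //.
  apply/setP=> x; rewrite !inE; apply/negP=> /andP[/TU/[apply]].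
  by rewrite eqxx.
split.
- apply: (N_ext cT) => // x xT; apply/subsetP=> y /UT/extensionsP[_].
  by move/(_ x xT) => [].
- by rewrite subUset sT.
- move=> x y /setUP[xT|xU] /setUP[yT|yU].
  + exact: iT.
  + by move/esym/eqP; rewrite (negPf (TU _ _ xT yU)).
  + by move/eqP; rewrite (negPf (TU _ _ yT xU)).
  + exact: iU.
Qed.

(** [W] becomes a block of order [j + 1]. Each block [B w] that loses a vertex [w] is refilled to
    [q w] from its own member [k w] of [F], and what remains of these members is discarded. *)
Lemma no_transversal (W : {set V}) :
  transversal_clique W -> #|W| = j.+1 -> False.
Proof.
move=> [cW /subsetP sW iW] cardW.
pose B w := pblock P w; pose k w := nth set0 (enum F) (index w (enum W)).
have BP w : w \in W -> B w \in P by move/sW/exchangeableP => [].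
have cB w : w \in W -> #|B w| = r.
  by move/sW/exchangeableP => [_ /andP[/eqP]].
have lek w : w \in W -> index w (enum W) < size (enum F).
  move=> wW; rewrite -cardE cardF; apply: leq_trans (_ : j.+1 <= _).
    by rewrite -cardW cardE index_mem mem_enum.
  by case/andP: j_lt_r => _ /ltnW.
have kF w : w \in W -> k w \in F by move/lek=> lt; rewrite -mem_enum mem_nth.
have ck w : w \in W -> #|k w| = j by move/kF/cardF_mem.
have ik : {in W &, injective k}.
  move=> x y xW yW /eqP; rewrite nth_uniq ?lek ?enum_uniq // => /eqP.
  by move/(index_inj x); apply; rewrite mem_enum.
have kB x y : x \in W -> y \in W -> k x != B y.
  move=> xW yW; apply: contraTneq j_lt_r => kB.
  by rewrite -(ck x xW) kB cB // ltnn andbF.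
have [q qP] : exists q : V -> {set V}, forall w, w \in W ->
    [&& clique (q w), #|q w| == r, q w \subset k w :|: B w & w \notin q w].
  have ex w : exists q : {set V}, w \in W ->
      [&& clique q, #|q| == r, q \subset k w :|: B w & w \notin q].
    have [wW|wW] := boolP (w \in W); last by exists set0.
    have /exchangeableP[_ _] := sW w wW; rewrite inE => /andP[_ /forall_inP].
    by move=> /(_ _ (kF w wW))/existsP[q]; exists q.
  by have [q qP] := fin_all_exists ex; exists q.
have cq w : w \in W -> #|q w| = r by case/qP/and4P=> _ /eqP.
have qs w z : w \in W -> z \in q w -> z \in k w \/ z \in B w.
  by case/qP/and4P=> _ _ /subsetP sq _ /sq /setUP.
have kP w : w \in W -> k w \in P by move/kF/FP.
have dq x y : x \in W -> y \in W -> x != y -> [disjoint q x & q y].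
  move=> xW yW xy; apply/pred0Pn=> -[z /=].
  case/andP=> /(qs _ _ xW) zx /(qs _ _ yW) zy.
  case: zx zy => zx [] zy.
  - have := block_eq (kP _ xW) (kP _ yW) zx zy.
    by move=> /(ik _ _ xW yW)/eqP; apply/negP.
  - by have /eqP := block_eq (kP _ xW) (BP _ yW) zx zy; apply/negP/kB.
  - by have /eqP := block_eq (kP _ yW) (BP _ xW) zy zx; apply/negP/kB.
  - have := block_eq (BP _ xW) (BP _ yW) zx zy.
    by move=> /(iW _ _ xW yW)/eqP; apply/negP.
have q0 w : w \in W -> q w != set0.
  by move=> wW; rewrite -card_gt0 cq // ltnW.
have iq : {in W &, injective q}.
  move=> x y xW yW qxy; apply/eqP; apply: contraT => /(dq x y xW yW).
  by rewrite qxy -setI_eq0 setIid (negPf (q0 y yW)).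
have dWq x : x \in W -> [disjoint W & q x].
  move=> xW; apply/pred0Pn=> -[z /= /andP[zW zq]].
  have [zk|zB] := qs x z xW zq.
    have /eqP := block_eq (kP x xW) (BP z zW) zk (mem_block z).
    by apply/negP/kB.
  have := block_eq (BP z zW) (BP x xW) (mem_block z) zB.
  by move=> /(iW _ _ zW xW) zx; rewrite zx in zq; case/qP/and4P: xW; rewrite zq.
have W0 : W != set0 by rewrite -card_gt0 cardW.
have WN : W \notin [set q w | w in W].
  apply/imsetP=> -[x xW Wq]; have := dWq x xW.
  by rewrite -Wq -setI_eq0 setIid (negPf W0).
have : weight r (W |: [set q w | w in W])
    <= weight r ([set k w | w in W] :|: [set B w | w in W]).
  apply: (optimal_exchange optP).
  - by apply/subsetP=> A /setUP[] /imsetP[w wW ->]; [apply: kP|apply: BP].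
  - apply: clique_familyU1 => //.
    + by rewrite cardW; case/andP: j_lt_r.
    + apply/clique_familyP; split=> [|A /imsetP[w wW ->]].
        apply/trivIsetP=> A1 A2 /imsetP[x xW ->] /imsetP[y yW ->] qxy.
        by apply: dq => //; apply: contraNneq qxy => ->.
      by case/qP/and4P: (wW) => -> /eqP-> _ _; rewrite q0.
    + by move=> A /imsetP[w wW ->]; apply: dWq.
  - apply/subsetP=> z /bigcupP[A /setU1P[->|/imsetP[w wW ->]]].
      move=> zW; apply/bigcupP; exists (B z); last exact: mem_block.
      by apply/setUP; right; apply: imset_f.
    move/(qs w z wW) => [] zA; apply/bigcupP.
      by exists (k w) => //; apply/setUP; left; apply: imset_f.
    by exists (B w) => //; apply/setUP; right; apply: imset_f.
(* The refilled blocks cancel against the old ones. What remains is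
   [r.+1 ^ j.+1 <= j.+1 * r.+1 ^ j], which contradicts [j < r]. *)
have -> : weight r (W |: [set q w | w in W]) = r.+1 ^ j.+1 + j.+1 * r.+1 ^ r.
  rewrite /weight big_setU1 //= cardW big_imset //=; congr (_ + _).
  by rewrite -cardW -sum_nat_const; apply: eq_bigr => w /cq->.
move=> /leq_trans/(_ (weightU_le _ _)).
have iB : {in W &, injective B} := iW.
rewrite /weight !big_imset //= (eq_bigr (fun=> r.+1 ^ j)).
  2: by move=> w /ck->.
rewrite [X in _ <= _ + X -> _](eq_bigr (fun=> r.+1 ^ r)).
  2: by move=> w /cB->.
rewrite !sum_nat_const cardW leq_add2r expnS leq_pmul2r ?expn_gt0 //.
by case/andP: j_lt_r => _ ltjr; rewrite ltnS leqNgt ltjr.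
Qed.

Hypothesis r_gt2 : 2 < r.
Hypothesis E_gt0 : 0 < E.
Variable e : rel V.
Hypothesis clique2 : forall x y, e x y -> clique [set x; y].
Hypothesis dense : forall S : {set V},
  #|V| <= r * #|S| + r ^ 5 * E -> r * #|V| < #|edges_in e S|.

(** Of about [j * #|V| / r] exchangeable vertices, each of the at most [j - 1] vertices of [T]
    excludes about [#|V| / r]. The errors sum to at most [2 * r ^ 3 * E + 2 * r ^ 4 * E], which
    [r ^ 5 * E] absorbs for [r >= 3]. *)
Lemma card_extensions_ge (T : {set V}) :
  clique T -> #|T| < j -> #|V| <= r * #|extensions T| + r ^ 5 * E.
Proof.
move=> cT; move: card_exchangeable (card_extensions cT).
move: #|extensions T| #|T| (r * #|exchangeable|) => s k z le_z le_s ltkj.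
have le_kE : k * (E + r * r) <= 2 * r ^ 3 * E.
  have : k * (E + r * r) <= r * (r * r * E + r * r * E).
    by apply: leq_mul; move: E_gt0; case/andP: j_lt_r; nia.
  by rewrite !expnS expn0 muln1; lia.
have le_jE : j * r * (r.+1 * j * E) <= 2 * r ^ 4 * E.
  have : j * r * (r.+1 * j * E) <= r * r * (2 * r * r * E).
    apply: leq_mul; first by apply: leq_mul => //; case/andP: j_lt_r => _ /ltnW.
    rewrite leq_mul2r; apply/orP; right; apply: leq_mul; first by lia.
    by case/andP: j_lt_r => _ /ltnW.
  by rewrite !expnS expn0 muln1; lia.
have le_E : 2 * r ^ 3 * E + 2 * r ^ 4 * E <= r ^ 5 * E.
  rewrite -mulnDl leq_mul2r; apply/orP; right; rewrite !expnS expn0 muln1.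
  by move: r_gt2; clear; nia.
have : j * #|V| <=
    r * s + k * #|V| + (k * (E + r * r) + j * r * (r.+1 * j * E)).
  by move: le_z le_s; rewrite !mulnDr; lia.
have : k.+1 * #|V| <= j * #|V| by rewrite leq_mul2r ltkj orbT.
by rewrite mulSn; lia.
Qed.

(** At most [r * #|V|] ordered pairs lie within a single block, fewer than the edges in [S]. *)
Lemma dense_cross_edge (S : {set V}) : #|V| <= r * #|S| + r ^ 5 * E ->
  exists u v, [/\ u \in S, v \in S, e u v & pblock P u != pblock P v].
Proof.
move=> /dense ltS.
suff : ~~ (edges_in e S \subset [set p | p.2 \in pblock P p.1]).
  case/subsetPn=> -[u v]; rewrite !inE /= => /and3P[uS vS euv] vu.
  by exists u, v; split=> //; apply: contraNneq vu => ->; apply: mem_block.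
apply: contraL ltS => /subset_leq_card sS; rewrite -leqNgt.
apply: leq_trans sS _; rewrite -sum1dep_card.
rewrite -(pair_big_dep xpredT (fun u v => v \in pblock P u) (fun _ _ => 1)) /=.
rewrite mulnC -cardsT -sum_nat_const big_mkcond [leqRHS]big_mkcond /=.
apply: leq_sum => u _; rewrite inE sum1_card.
by apply: (optimal_card optP); rewrite pblock_mem // coverP inE.
Qed.

Lemma transversal_clique_small (k : nat) :
  k < j -> exists2 T, transversal_clique T & #|T| = k.
Proof.
elim: k => [_|k IHk ltkj].
  exists set0; last by rewrite cards0.
  have [K KF] : exists K, K \in F by apply/card_gt0P; rewrite cardF.
  split; last by move=> x y; rewrite inE.
    by apply: cliqueS (sub0set K) _; apply: Fclique.
  exact: sub0set.
have [T TT Tk] := IHk (ltnW ltkj); have [cT _ _] := TT.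
have : #|V| <= r * #|extensions T| + r ^ 5 * E.
  by apply: card_extensions_ge; rewrite ?Tk // ltnW.
(* The edge serves to show that [extensions T] is nonempty; its tail is added to [T]. *)
case/dense_cross_edge=> u [_ [uT _ _ _]].
have TU : transversal_clique [set u].
  split=> //; first by rewrite sub1set; case: (extensionsP uT).
  by move=> x y /set1P-> /set1P->.
have sU : [set u] \subset extensions T by rewrite sub1set.
have [TTU cTU] := transversal_cliqueU TT TU sU.
by exists (T :|: [set u]); rewrite // cTU cards1 addn1 Tk.
Qed.

(** An edge between two blocks inside the extensions of a transversal clique of order [j - 1]
    completes it to order [j + 1]. *)
Lemma augmentation : False.
Proof.
have [j0 _] := andP j_lt_r.
have ltj : j.-1 < j by rewrite prednK.
have [T TT Tk] := transversal_clique_small ltj.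
have [cT _ _] := TT.
have : #|V| <= r * #|extensions T| + r ^ 5 * E.
  by apply: card_extensions_ge; rewrite ?Tk // prednK.
case/dense_cross_edge=> u [v [uT vT euv uv]].
have TU : transversal_clique [set u; v].
  split; first exact: clique2.
    rewrite subUset !sub1set; case: (extensionsP uT) => -> _.
    by case: (extensionsP vT).
  move=> x y /set2P[]-> /set2P[]-> // /eqP; first by rewrite (negPf uv).
  by rewrite eq_sym (negPf uv).
have sU : [set u; v] \subset extensions T by rewrite subUset !sub1set uT.
have [TTU cTU] := transversal_cliqueU TT TU sU.
have uv' : u != v by apply: contraNneq uv => ->.
by apply: (no_transversal TTU); rewrite cTU cards2 uv' Tk addn2 prednK.
Qed.

End Augmentation.

(** * An almost perfect packing, with integer error terms *)

Lemma subset_of_card (T : finType) (A : {set T}) (m : nat) :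
  (m <= #|A|)%N -> exists2 B : {set T}, B \subset A & #|B| = m.
Proof.
move=> /card_geqP[s [us <- sA]]; exists [set x in s].
  by apply/subsetP=> x; rewrite inE => /sA.
by rewrite cardsE; apply/card_uniqP.
Qed.

Section AlmostPerfectPacking.

Local Open Scope nat_scope.

Variables (V : finType) (e : rel V) (r E : nat) (a b : pred V).
Hypothesis e_irr : irreflexive e.
Hypothesis r_gt2 : 2 < r.
Hypothesis E_gt0 : 0 < E.
Hypothesis abN : forall x, ~~ (a x && b x).
Hypothesis ab_edge : forall x y, a x -> b y -> ~~ e x y.
Hypothesis out_deg :
  forall x, ~~ a x -> r * #|~: [set y | e x y]| <= #|V| + E.
Hypothesis in_deg :
  forall x, ~~ b x -> r * #|~: [set y | e y x]| <= #|V| + E.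
Hypothesis dense : forall S : {set V},
  #|V| <= r * #|S| + r ^ 5 * E -> r * #|V| < #|edges_in e S|.

Let r_gt1 : 1 < r := ltnW r_gt2.
Let tS (S T : {set V}) (sST : S \subset T) :
  transitive_set e T -> transitive_set e S := transitive_setS e_irr sST.

Lemma few_blocks (P : {set {set V}}) (j : nat) :
    optimal (transitive_set e) r P -> 0 < j < r ->
  #|[set K in P | #|K| == j]| <= r.
Proof.
move=> optP jr; rewrite leqNgt; apply/negP=> /subset_of_card[F sF cF].
have sFP : F \subset P.
  by apply: subset_trans sF _; apply/subsetP=> K; rewrite inE => /andP[].
have Fj K : K \in F -> #|K| = j.
  by move/(subsetP sF); rewrite inE => /andP[_ /eqP].
have exN K : exists NK : V -> {set V}, transitive_set e K ->
    (forall x, x \in K -> (NK x = [set y | e x y] /\ ~~ a x) \/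
                          (NK x = [set y | e y x] /\ ~~ b x)) /\
    (forall K' T : {set V}, K' \subset K -> transitive_set e T ->
       (forall x, x \in K' -> T \subset NK x) -> transitive_set e (K' :|: T)).
  (* Directions are chosen for all sets at once; [set0] is a dummy value for sets that are not
     cliques. *)
  have [tK|_] := boolP (transitive_set e K); last by exists (fun=> set0).
  have [NK NKP] := transitive_set_directions e_irr abN ab_edge tK.
  by exists NK.
have [N NP] := fin_all_exists exN.
apply: (augmentation (N := N) r_gt1 (transitive_set1 e_irr) tS _ _ _
  optP sFP cF Fj jr r_gt2 E_gt0 (transitive_set2 e_irr) dense).
- by move=> K x tK /(proj1 (NP K tK) x)[] [-> _]; rewrite inE e_irr.
- move=> K x tK /(proj1 (NP K tK) x)[] [->]; [exact: out_deg|exact: in_deg].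
- by move=> K K' T tK; apply: (proj2 (NP K tK)).
Qed.

Lemma almost_perfect_packing :
  exists P : {set {ffun 'I_r -> V}}, Tr_packing e P /\ #|~: covered P| <= r ^ 3.
Proof.
have [P optP] := optimal_exists (transitive_set e) r.
have embP (Q : {Q : {set V} | Q \in [set Q in P | #|Q| == r]}) :
    exists f : {ffun 'I_r -> V}, Tr_copy e f /\ [set f i | i : 'I_r] = val Q.
  case: Q => Q /=; rewrite inE => /andP[QP /eqP Qr].
  exact: transitive_set_embedding (optimal_clique optP QP) Qr.
have [f fP] := fin_all_exists embP.
have valP' (Q : {Q : {set V} | Q \in [set Q in P | #|Q| == r]}) :
  val Q \in P.
  by case: Q => Q /=; rewrite inE => /andP[].
exists [set f Q | Q in setT]; split; first split.
- by move=> _ /imsetP[Q _ ->]; case: (fP Q).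
- move=> _ _ /imsetP[Q1 _ ->] /imsetP[Q2 _ ->] f12.
  have Q12 : val Q1 != val Q2 by apply: contraNneq f12 => /val_inj->.
  apply/pred0Pn=> -[x /= /andP[/codomP[i1 x1] /codomP[i2 x2]]].
  have xQ1 : x \in val Q1 by case: (fP Q1) => _ <-; rewrite x1 imset_f.
  have := disjointFr (optimal_disjoint optP (valP' Q1) (valP' Q2) Q12) xQ1.
  by case: (fP Q2) => _ <-; rewrite x2 imset_f.
(* Uncovered vertices lie in blocks of order [j < r]. There are [r] values of [j], at most [r]
   blocks for each (none for [j = 0]), and at most [r] vertices in each block. *)
have sU : ~: covered [set f Q | Q in setT]
    \subset \bigcup_(K in \bigcup_(j < r) [set K in P | #|K| == j]) K.
  apply/subsetP=> x; rewrite inE => xN.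
  have : x \in cover P.
    by rewrite (optimal_cover (transitive_set1 e_irr) optP (ltnW r_gt1)) inE.
  case/bigcupP=> K KP xK; apply/bigcupP; exists K => //.
  have := optimal_card optP KP; rewrite leq_eqVlt => /orP[Kr|Kr]; last first.
    by apply/bigcupP; exists (Ordinal Kr); rewrite // inE KP /=.
  case/negP: xN; have KR : K \in [set Q in P | #|Q| == r] by rewrite inE KP.
  apply/bigcupP; exists (f (exist _ K KR)); first by rewrite imset_f.
  by case: (fP (exist _ K KR)) => _ ->.
apply: leq_trans (subset_leq_card sU) _.
apply: leq_trans (card_bigcup_le _ _) _.
apply: (@leq_trans (\sum_(K in \bigcup_(j < r) [set K in P | #|K| == j]) r)).
  apply: leq_sum => K /bigcupP[j _]; rewrite inE => /andP[_ /eqP->].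
  exact: ltnW.
rewrite sum_nat_const !expnS expn0 muln1 mulnA leq_mul2r; apply/orP; right.
apply: leq_trans (card_bigcup_le _ _) _.
rewrite -[X in _ <= X * _]card_ord -sum_nat_const; apply: leq_sum => j _.
have [j0|j0] := posnP j; last by apply: few_blocks; rewrite // j0 /=.
rewrite (_ : [set K in P | _] = set0) ?cards0 //; apply/setP=> K.
rewrite !inE j0 cards_eq0; apply/negP=> /andP[KP].
by rewrite (negPf (optimal_neq0 optP KP)).
Qed.

End AlmostPerfectPacking.

(** * The choice of constants and the passage to real bounds *)

Lemma card_edges_in_le (V : finType) (e : rel V) (S T : {set V}) :
  (#|edges_in e T| <= #|edges_in e S| + 2 * #|T :\: S| * #|V|)%N.
Proof.
have : edges_in e T \subset
    edges_in e S :|: (setX (T :\: S) [set: V] :|: setX [set: V] (T :\: S)).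
  apply/subsetP=> -[x y]; rewrite !inE /= => /and3P[-> -> ->].
  by rewrite !andbT; do 2 case: (_ \in S).
move=> /subset_leq_card/leq_trans; apply.
apply: leq_trans (leq_card_setU _ _) _; rewrite leq_add2l.
apply: leq_trans (leq_card_setU _ _) _.
by rewrite !cardsX cardsT; lia.
Qed.

(** A sparse set slightly smaller than [#|V| / r] has to be enlarged to the size required of an
    independent set; the last summand [r] accounts for rounding. *)
Lemma large_superset (V : finType) (S : {set V}) (r : nat) :
  (1 < r -> 1 < #|V| -> exists T : {set V},
    #|V| <= r * #|T| /\ r * #|T :\: S| <= #|V| - r * #|S| + r)%N.
Proof.
move=> r1 V1; have [le|lt] := leqP #|V| (r * #|S|).
  by exists S; rewrite setDv cards0 muln0.
have lt_m : (#|V| %/ r < #|V|)%N by rewrite ltn_Pdiv // ltnW.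
have lt_Vr : (#|V| < (#|V| %/ r).+1 * r)%N by rewrite ltn_ceil // ltnW.
have le_Vr : (#|V| %/ r * r <= #|V|)%N by apply: leq_divM.
have cS : (#|S| + #|~: S| = #|V|)%N by apply: cardsC.
have leS : (#|S| <= (#|V| %/ r).+1)%N.
  by apply/ltnW; rewrite ltnS leq_divRL 1?mulnC 1?ltnW // ltnW.
have [|B BS cB] := @subset_of_card V (~: S) ((#|V| %/ r).+1 - #|S|)%N.
  by lia.
exists (S :|: B).
have SB : (S :|: B) :\: S = B.
  by rewrite setDUl setDv set0U; apply/setDidPl; rewrite disjoints_subset.
rewrite SB cardsU (_ : S :&: B = set0) ?cards0 ?cB; last first.
  by apply/eqP; rewrite setIC setI_eq0 disjoints_subset.
by split; nia.
Qed.

Theorem theorem5p4 (R : realType) :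
  exists f1 f2 f3 f4 : R -> R,
    [/\ hierarchy_fun f1, hierarchy_fun f2, hierarchy_fun f3
      & hierarchy_fun f4] /\
    forall (n l r : nat) (eps gamma : R),
      (3 <= r)%N ->
      0 < gamma <= f1 r%:R^-1 ->
      0 < eps <= f2 gamma ->
      (0 : R) < l%:R^-1 <= f3 eps ->
      (0 : R) < n%:R^-1 <= f4 l%:R^-1 ->
    forall (V : finType) (e : rel V),
      irreflexive e ->
      #|V| = n ->
      (forall x : V,
          (1 - r%:R^-1 - eps) * n%:R <= (outdeg e x)%:R
          \/ (1 - r%:R^-1 - eps) * n%:R <= (indeg e x)%:R) ->
      (forall x y : V,
          (outdeg e x)%:R < (1 - r%:R^-1 - eps) * n%:R ->
          (indeg e y)%:R < (1 - r%:R^-1 - eps) * n%:R ->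
          ~~ e x y) ->
      (exists P : {set {ffun 'I_r -> V}},
          Tr_packing e P /\ (#|~: covered P| <= l)%N)
      \/
      (exists S : {set V},
          gamma_independent e gamma S /\ n%:R / r%:R <= #|S|%:R :> R).
Proof.
have hierarchy_id : hierarchy_fun (@id R) by split.
(* From [r * gamma <= 1] and [eps <= gamma ^+ 6 / 20] follows [r ^ 5 * eps <= gamma / 20]. The other
   bounds give [eps * l >= 1], hence [r ^ 3 <= l], and [eps * n >= 1]. *)
exists id, (fun x => x ^+ 6 / 20), id, id; split.
  split=> //; split=> [x x0|x y x0 xy].
    by rewrite divr_gt0 ?exprn_gt0.
  by rewrite ltr_pM2r ?invr_gt0 // ltrXn2r // ltW // (lt_trans x0).
move=> n l r eps gamma r3 /andP[g0 gr] /andP[e0 eg] /andP[l0 le] /andP[n0 nl].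
move=> V e e_irr cV deg edge.
rewrite invr_gt0 in l0; rewrite invr_gt0 in n0.
have r0 : 0 < r%:R :> R by rewrite ltr0n (leq_trans _ r3).
have r3R : 3 <= r%:R :> R by rewrite (ler_nat R 3).
have nR : 1 <= eps * n%:R.
  by have := le_trans nl le; rewrite -div1r ler_pdivrMr.
have lR : 1 <= eps * l%:R by move: le; rewrite -div1r ler_pdivrMr.
have rg : r%:R * gamma <= 1 by rewrite mulrC -ler_pdivlMr // div1r.
have r5 : r%:R ^+ 5 * eps <= gamma / 20.
  apply: (@le_trans _ _ (r%:R ^+ 5 * (gamma ^+ 6 / 20))).
    by rewrite ler_pM2l ?exprn_gt0.
  have -> : r%:R ^+ 5 * (gamma ^+ 6 / 20) = (r%:R * gamma) ^+ 5 * (gamma / 20).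
    by rewrite exprMn; field.
  apply: ler_piMl; first by rewrite divr_ge0 // ltW.
  by apply: exprn_ile1; rewrite // mulr_ge0 // ltW.
have g1 : gamma <= 1 by nra.
have r3l : (r ^ 3 <= l)%N.
  rewrite -(ler_nat R) natrX.
  have : r%:R ^+ 3 * eps <= 1.
    apply: le_trans (_ : r%:R ^+ 5 * eps <= _); last by lra.
    by rewrite ler_pM2r // ler_weXn2l //; lra.
  by move=> h; rewrite -(ler_pM2r e0) (le_trans h) // mulrC.
have [/existsP[S /andP[S1 S2]]|/existsPn noS] := boolP [exists S : {set V},
  (#|edges_in e S|%:R <= gamma * #|V|%:R ^+ 2) &&
  (n%:R / r%:R <= #|S|%:R :> R)].
  by right; exists S.
left.
set d := (1 - r%:R^-1 - eps) * n%:R in deg edge.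
(* A positive integer above [r * eps * n] by at most 1; from here on only these bounds on [E]
   matter. *)
pose E := (Num.truncn (r%:R * eps * n%:R)).+1.
have ren0 : 0 <= r%:R * eps * n%:R by rewrite !mulr_ge0 // ltW.
have /andP[E1 E2] := truncn_itv ren0; rewrite -/E in E2.
have E1' : E%:R <= r%:R * eps * n%:R + 1 by rewrite -natr1 lerD2r.
have E0 : (0 < E)%N by [].
clearbody E.
have degP (A : {set V}) : d <= #|A|%:R -> (r * #|~: A| <= #|V| + E)%N.
  move=> dA; rewrite -(ler_nat R) natrM natrD cV.
  have : #|A|%:R + #|~: A|%:R = n%:R :> R by rewrite -natrD cardsC cV.
  move: dA; rewrite /d => dA cA.
  have : r%:R * d <= r%:R * #|A|%:R by rewrite ler_pM2l.
  have -> : r%:R * d = (r%:R - 1 - r%:R * eps) * n%:R.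
    by rewrite /d; field; rewrite gt_eqF.
  by move: cA E2; nra.
have e1 : eps < 1 by have := exprn_ile1 6 (ltW g0) g1; lra.
have n_gt1 : (1 < #|V|)%N.
  by rewrite cV -(ltr_nat R) (le_lt_trans nR) // -[ltRHS]mul1r ltr_pM2r.
have dense (S : {set V}) :
    (#|V| <= r * #|S| + r ^ 5 * E)%N -> (r * #|V| < #|edges_in e S|)%N.
  move=> leS; rewrite ltnNge; apply/negP=> le_edges.
  have [T [T1 T2]] := large_superset S (ltnW r3) n_gt1.
  (* Divide [r * #|T :\: S| <= r ^ 5 * E + r] by [r]. *)
  have T3 : (#|T :\: S| <= 1 + r ^ 4 * E)%N.
    rewrite -(leq_pmul2l (ltnW (ltnW r3))) mulnDr mulnA -expnS muln1.
    by apply: leq_trans T2 _; rewrite addnC leq_add2l leq_subLR.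
  have T4 : #|T :\: S|%:R <= 1 + r%:R ^+ 4 * (r%:R * eps * n%:R + 1) :> R.
    apply: (@le_trans _ _ (1 + r%:R ^+ 4 * E%:R)).
      by rewrite -natrX -natrM nat1r ler_nat -add1n.
    by rewrite lerD2l ler_pM2l ?exprn_gt0.
  have := noS T; rewrite negb_and -!ltNge; case/orP; last first.
    by apply/negP; rewrite -leNgt ler_pdivrMr // -natrM ler_nat -cV mulnC.
  apply/negP; rewrite -leNgt.
  apply: (@le_trans _ _ (r%:R * n%:R + 2 * #|T :\: S|%:R * n%:R)).
    rewrite -cV -!natrM -natrD ler_nat.
    by apply: leq_trans (card_edges_in_le e S T) _; rewrite leq_add2r.
  rewrite cV expr2 mulrA -mulrDl ler_pM2r //.
  (* The terms free of [eps] are at most [3 * r ^ 4 <= r ^ 5], and [r ^ 5 <= r ^ 5 * eps * n]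
     because [eps * n >= 1]. *)
  apply: (@le_trans _ _ (5 * r%:R ^+ 5 * eps * n%:R)).
    have r4 : r%:R + 2 <= r%:R ^+ 4 :> R.
      apply: (@le_trans _ _ (r%:R ^+ 2)); last by rewrite ler_weXn2l //; lra.
      by rewrite expr2; move: r3R; clear; nra.
    have r45 : 3 * r%:R ^+ 4 <= r%:R ^+ 5 :> R.
      by rewrite [leRHS]exprS ler_pM2r ?exprn_gt0.
    have : r%:R ^+ 5 <= r%:R ^+ 5 * (eps * n%:R) :> R.
      by apply: ler_peMr => //; rewrite exprn_ge0 // ltW.
    by move: T4 r4 r45 r3R; clear; lra.
  by rewrite ler_pM2r // -mulrA; lra.
have [P [PT cP]] : exists P : {set {ffun 'I_r -> V}},
    Tr_packing e P /\ (#|~: covered P| <= r ^ 3)%N.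
  apply: (@almost_perfect_packing V e r E
    (fun x => (outdeg e x)%:R < d) (fun x => (indeg e x)%:R < d)) => //.
  - by move=> x; rewrite negb_and -!leNgt; apply/orP/deg.
  - by move=> x; rewrite -leNgt; apply: degP.
  - by move=> x; rewrite -leNgt; apply: degP.
by exists P; split=> //; apply: leq_trans r3l.
Qed.
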